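(* Consider the $N$-agent risk-averse game in which agent $i$ solves $\min_{x_i\in\mathcal{X}_i}C_i(x_i,x_{-i})$ with $C_i(x)=\mathrm{CVaR}_{\alpha_i}[J_i(x,\xi_i)]$, $\alpha_i\in(0,1]$, in the setting of the context. Assume that for each agent $i$ the cost decomposes as $J_i(x,\xi_i)=f_i(x_i,\xi_i)+g_i(x)$, where: for every $x_i\in\mathcal{X}_i$ the random variable $f_i(x_i,\xi_i)$ is absolutely continuous and its VaR value is differentiable in $x_i$; $f_i(x_i,\xi_i)$ is convex in $x_i$ for every $\xi_i\in\Xi_i$; and the functions $g_i$ satisfy $$\sum_{i=1}^N\langle\nabla_ig_i(x)-\nabla_ig_i(x'),x_i-x_i'\rangle\ge m\|x-x'\|^2\qquad\text{for all }x,x'\in\mathcal{X}.$$ Then the risk-averse game is $m$-strongly monotone, i.e. $$\sum_{i=1}^N\langle\nabla_iC_i(x)-\nabla_iC_i(x'),x_i-x_i'\rangle\ge m\|x-x'\|^2\qquad\text{for all }x,x'\in\mathcal{X}.$$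
   Context: There are $N$ agents; agent $i$ chooses $x_i\in\mathcal{X}_i\subseteq\mathbb{R}^d$, a convex set of diameter at most $D$. $\mathcal{X}=\prod_{i=1}^N\mathcal{X}_i$, $x=(x_1,\dots,x_N)=(x_i,x_{-i})$. $\xi_i\in\Xi_i\subset\mathbb{R}^{n_\xi}$ is a random variable with a fixed distribution; $J_i:\mathcal{X}\times\Xi_i\to\mathbb{R}$ is the stochastic cost, convex in $x_i$ for every $x_{-i}$ and $\xi_i$, and $J_i(\cdot,\xi_i)$ is Lipschitz and differentiable for every $\xi_i$. $\nabla_i$ denotes the partial gradient with respect to $x_i$, and $\|\cdot\|$ is the Euclidean norm. For a random variable $Z$ with CDF $F$ and $\alpha\in(0,1]$, $\mathrm{VaR}_\alpha[Z]=\inf\{y:F(y)\ge1-\alpha\}$ (equal to $-\infty$ if $\alpha=1$), and $\mathrm{CVaR}_\alpha[Z]=\mathbb{E}[Z\mid Z\ge\mathrm{VaR}_\alpha[Z]]$ (equivalently $\min_{\nu\in\mathbb{R}}\{\nu+\frac1\alpha\mathbb{E}[Z-\nu]_+\}$, with $[z]_+=\max\{z,0\}$; for $\alpha=1$ this is $\mathbb{E}[Z]$).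
   Formalization: The inequality is stated at all x, x' where the gradients of the C_i exist, since they can fail to exist on the boundary if the Lipschitz constant of J_i(·,ξ_i) is not integrable in ξ_i; existence on all of X is also stated for an integrable (e.g. uniform) constant. *)

(* Defs.v *)
From HB Require Import structures.
From mathcomp Require Import all_boot all_order all_algebra.
From mathcomp Require Import all_classical all_reals all_analysis.

Set Implicit Arguments.
Unset Strict Implicit.
Unset Printing Implicit Defensive.

Import Order.TTheory GRing.Theory Num.Theory.
Import numFieldNormedType.Exports.

Local Open Scope classical_set_scope.
Local Open Scope ring_scope.

(* Actions are row vectors in 'rV[R]_d; an action profile x = (x_1, ..., x_N)
   is the N x d matrix x whose i-th row is x_i.  The library norm on matrices is
   the max norm, hence the Euclidean inner product and norm below. *)

Definition dotp (R : realType) (p q : nat) (u v : 'M[R]_(p, q)) : R :=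
  \sum_(i < p) \sum_(j < q) u i j * v i j.

Definition enorm (R : realType) (p q : nat) (u : 'M[R]_(p, q)) : R :=
  Num.sqrt (dotp u u).

(* v is a gradient at u of h : A -> R.  Only the values of h on A matter, as the
   functions considered here are only given on the action sets.  If A is convex,
   dotp v (y - u) for y in A does not depend on the choice of v (it is the
   one-sided derivative of h at u in the direction y - u); v itself is unique
   when A has nonempty interior. *)
Definition is_gradient (R : realType) (p q : nat) (A : set 'M[R]_(p, q))
    (h : 'M[R]_(p, q) -> R) (u v : 'M[R]_(p, q)) : Prop :=
  forall e : R, 0 < e ->
    \forall y \near within A (nbhs u),
      `|h y - h u - dotp v (y - u)| <= e * enorm (y - u).

Definition differentiable_on (R : realType) (p q : nat) (A : set 'M[R]_(p, q))
    (h : 'M[R]_(p, q) -> R) : Prop :=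
  forall u, A u -> exists v, is_gradient A h u v.

Definition gradient (R : realType) (p q : nat) (A : set 'M[R]_(p, q))
    (h : 'M[R]_(p, q) -> R) (u : 'M[R]_(p, q)) : 'M[R]_(p, q) :=
  get [set v | is_gradient A h u v].

Definition profiles (R : realType) (N d : nat) (X : 'I_N -> set 'rV[R]_d) :
    set 'M[R]_(N, d) :=
  [set x | forall i, X i (row i x)].

(* (u, x_{-i}) *)
Definition set_action (R : realType) (N d : nat) (x : 'M[R]_(N, d)) (i : 'I_N)
    (u : 'rV[R]_d) : 'M[R]_(N, d) :=
  \matrix_(k, l) (if k == i then u 0 l else x k l).

Definition pdifferentiable (R : realType) (N d : nat)
    (X : 'I_N -> set 'rV[R]_d) (i : 'I_N) (h : 'M[R]_(N, d) -> R)
    (x : 'M[R]_(N, d)) : Prop :=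
  exists v, is_gradient (X i) (fun u => h (set_action x i u)) (row i x) v.

Definition pgradient (R : realType) (N d : nat)
    (X : 'I_N -> set 'rV[R]_d) (i : 'I_N) (h : 'M[R]_(N, d) -> R)
    (x : 'M[R]_(N, d)) : 'rV[R]_d :=
  gradient (X i) (fun u => h (set_action x i u)) (row i x).

Definition strongly_monotone_at (R : realType) (N d : nat)
    (X : 'I_N -> set 'rV[R]_d) (m : R) (h : 'I_N -> 'M[R]_(N, d) -> R)
    (x x' : 'M[R]_(N, d)) : Prop :=
  \sum_(i < N) dotp (pgradient X i (h i) x - pgradient X i (h i) x')
                    (row i x - row i x')
  >= m * enorm (x - x') ^+ 2.

(* For alpha = 1 every real y qualifies, so the infimum is -oo. *)
Definition VaR (dsp : measure_display) (T : measurableType dsp) (R : realType)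
    (P : probability T R) (alpha : R) (Z : T -> R) : \bar R :=
  ereal_inf [set y%:E | y in
    [set y : R | ((1 - alpha)%:E <= P [set w | (Z w <= y)%R])%E]].

Definition CVaR (dsp : measure_display) (T : measurableType dsp) (R : realType)
    (P : probability T R) (alpha : R) (Z : T -> R) : \bar R :=
  let A := [set w | (VaR P alpha Z <= (Z w)%:E)%E] in
  (((fine (P A))^-1)%:E * \int[P]_(w in A) (Z w)%:E)%E.

(* C_i(x) = CVaR_{alpha_i}[J_i(x, xi_i)]; meaningful when the CVaR is finite. *)
Definition risk_cost (dsp : measure_display) (T : measurableType dsp)
    (R : realType) (P : probability T R) (N d n : nat) (alpha : 'I_N -> R)
    (J : 'I_N -> 'M[R]_(N, d) -> 'rV[R]_n -> R) (xi : 'I_N -> T -> 'rV[R]_n)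
    (i : 'I_N) (x : 'M[R]_(N, d)) : R :=
  fine (CVaR P (alpha i) (fun w => J i x (xi i w))).

(* Main.v *)
(** Write [A] for an upper tail event of [Z] of probability [a], so that
    [a * CVaR_a Z] is the integral of [Z] over [A].  Among all events of
    probability [a], the integral of [Z] is largest on [A].  Applied to the tail
    event of a convex combination this makes CVaR convex, and it also makes CVaR
    translation equivariant; hence [C_i - g_i] is a convex function of the
    action of player [i] alone, its gradient is monotone, and the strong
    monotonicity of [g] passes to [C].

    For differentiability, replacing [Z0] by [Z1] with [|Z1 - Z0| <= M] changes
    [a * CVaR] by the integral of [Z1 - Z0] over the tail event of [Z0], up to
    the integral of [M] over the event that [Z0] is within [M] of its quantile.
    With [M] proportional to the displacement the latter is negligible because
    [Z0] has no atom, and dominated convergence gives the gradient as the tail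
    average of the gradients of [J_i]. *)
Require Import Defs.
From HB Require Import structures.
From mathcomp Require Import all_boot all_order all_algebra.
From mathcomp Require Import all_classical all_reals all_analysis.
From mathcomp Require Import measurable_realfun lra.
Import Order.TTheory GRing.Theory Num.Theory.
Import numFieldNormedType.Exports.
Local Open Scope classical_set_scope.
Local Open Scope ring_scope.

(** * Euclidean inner product and norm, and their agreement with the matrix topology *)

Section inner_product.
Context {R : realType} {p q : nat}.
Implicit Types u v w : 'M[R]_(p, q).

Lemma dotpC u v : dotp u v = dotp v u.
Proof. by apply: eq_bigr => i _; apply: eq_bigr => j _; rewrite mulrC. Qed.

Lemma dotpDl u v w : dotp (u + v) w = dotp u w + dotp v w.
Proof.
rewrite -big_split; apply: eq_bigr => i _ /=; rewrite -big_split.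
by apply: eq_bigr => j _ /=; rewrite mxE mulrDl.
Qed.

Lemma dotpZl a u v : dotp (a *: u) v = a * dotp u v.
Proof.
rewrite mulr_sumr; apply: eq_bigr => i _; rewrite mulr_sumr.
by apply: eq_bigr => j _; rewrite mxE mulrA.
Qed.

Lemma dotpNl u v : dotp (- u) v = - dotp u v.
Proof. by rewrite -scaleN1r dotpZl mulN1r. Qed.

Lemma dotpNr u v : dotp u (- v) = - dotp u v.
Proof. by rewrite dotpC dotpNl dotpC. Qed.

Lemma dotpBl u v w : dotp (u - v) w = dotp u w - dotp v w.
Proof. by rewrite dotpDl dotpNl. Qed.

Lemma dotpZr a u v : dotp u (a *: v) = a * dotp u v.
Proof. by rewrite dotpC dotpZl dotpC. Qed.

Lemma dotp0r u : dotp u 0 = 0.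
Proof. by rewrite -(scale0r 0) dotpZr mul0r. Qed.

Lemma dotp_ge0 u : 0 <= dotp u u.
Proof. by apply: sumr_ge0 => i _; apply: sumr_ge0 => j _; rewrite sqr_ge0. Qed.

Lemma enorm_ge0 u : 0 <= enorm u.
Proof. exact: sqrtr_ge0. Qed.

Lemma enorm0 : enorm (0 : 'M[R]_(p, q)) = 0.
Proof. by rewrite /enorm dotp0r sqrtr0. Qed.

Lemma enormZ a u : enorm (a *: u) = `|a| * enorm u.
Proof. by rewrite /enorm dotpZl dotpZr mulrA -expr2 sqrtrM ?sqr_ge0// sqrtr_sqr. Qed.

Lemma ler_norm_enorm u i j : `|u i j| <= enorm u.
Proof.
rewrite -sqrtr_sqr ler_sqrt ?dotp_ge0// /dotp (bigD1 i)//= (bigD1 j)//= -expr2.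
rewrite -addrA lerDl addr_ge0//; first by apply: sumr_ge0 => k _; rewrite sqr_ge0.
by apply: sumr_ge0 => k _; apply: sumr_ge0 => l _; rewrite sqr_ge0.
Qed.

Lemma enorm_eq0 u : enorm u = 0 -> u = 0.
Proof.
move=> u0; apply/matrixP => i j; rewrite mxE; apply/normr0_eq0/eqP.
by rewrite eq_le normr_ge0 andbT -u0 ler_norm_enorm.
Qed.

(** The sharp factor is the square root of [p * q]; its successor avoids the root, since
    [k <= k.+1 ^ 2]. *)
Lemma enorm_le_max u e : (forall i j, `|u i j| <= e) -> 0 <= e ->
  enorm u <= (p * q).+1%:R * e.
Proof.
move=> ue e0; rewrite -[leRHS]ger0_norm ?mulr_ge0// -sqrtr_sqr ler_sqrt ?sqr_ge0//.
apply: (@le_trans _ _ (\sum_(i < p) \sum_(j < q) e ^+ 2)).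
  apply: ler_sum => i _; apply: ler_sum => j _.
  by rewrite -expr2 -real_normK ?num_real// lerXn2r ?nnegrE.
rewrite sumr_const sumr_const !card_ord -mulrnA exprMn -[leLHS]mulr_natl ler_wpM2r ?sqr_ge0//.
by rewrite -natrX ler_nat mulnC (leq_trans (leqnSn _))// -[leqLHS]expn1 leq_pexp2l.
Qed.

(** Euclidean and max-norm balls contain one another up to a dimensional factor. *)
Lemma near_within_enormP (A : set 'M[R]_(p, q)) u (Q : 'M[R]_(p, q) -> Prop) :
  (\forall y \near within A (nbhs u), Q y) <->
  exists2 e, 0 < e & forall y, A y -> enorm (y - u) < e -> Q y.
Proof.
rewrite near_withinE; split.
  move/nbhs_ballP => [e /= e0 eQ]; exists e => // y Ay ye; apply: eQ => //.
  split=> // i j; rewrite /ball /=; apply: le_lt_trans ye.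
  by apply: le_trans (ler_norm_enorm _ i j); rewrite !mxE distrC.
move=> [e e0 eQ]; apply/nbhs_ballP.
(* The comparison of norms costs a factor [(p * q).+1]; dividing by one more keeps the bound
   strictly below [e]. *)
exists (e / (p * q).+2%:R) => /=; first by rewrite divr_gt0.
move=> y [_ uy] Ay; apply: eQ => //.
apply: (@le_lt_trans _ _ ((p * q).+1%:R * (e / (p * q).+2%:R))).
  apply: enorm_le_max => [i j|]; last by rewrite divr_ge0// ltW.
  by rewrite !mxE distrC; apply: ltW; exact: uy.
by rewrite mulrA ltr_pdivrMr// mulrC ltr_pM2l// ltr_nat.
Qed.

End inner_product.

(** * Gradients relative to a set and their directional estimates *)

Section gradients.
Context {R : realType} {p q : nat}.
Implicit Types (u v w : 'M[R]_(p, q)) (A : set 'M[R]_(p, q)) (h k : 'M[R]_(p, q) -> R).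

Lemma is_gradientP A h u v : is_gradient A h u v <->
  forall e, 0 < e -> exists2 t, 0 < t & forall y, A y -> enorm (y - u) < t ->
    `|h y - h u - dotp v (y - u)| <= e * enorm (y - u).
Proof.
by split=> H e e0; [apply/near_within_enormP | apply/near_within_enormP]; exact: H.
Qed.

Lemma is_gradientB A h k u v w : is_gradient A h u v -> is_gradient A k u w ->
  is_gradient A (fun y => h y - k y) u (v - w).
Proof.
move=> /is_gradientP hv /is_gradientP kw; apply/is_gradientP => e e0.
have e20 : 0 < e / 2 by rewrite divr_gt0.
have [s s0 Hs] := hv _ e20; have [t t0 Ht] := kw _ e20.
exists (Num.min s t); first by rewrite lt_min s0.
move=> y Ay; rewrite lt_min => /andP[ys yt].
have := Hs _ Ay ys; have := Ht _ Ay yt; rewrite dotpBl.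
set a := dotp v _; set b := dotp w _; set r := enorm _.
by rewrite !ler_norml; lra.
Qed.

Lemma eq_is_gradient A h k u v : A u -> (forall y, A y -> h y = k y) ->
  is_gradient A h u v -> is_gradient A k u v.
Proof.
move=> Au hk /is_gradientP H; apply/is_gradientP => e /H[t t0 Ht].
by exists t => // y Ay yt; rewrite -!hk//; exact: Ht.
Qed.

Lemma is_gradientN A h u v : is_gradient A h u v ->
  is_gradient A (fun y => - h y) u (- v).
Proof.
move=> /is_gradientP H; apply/is_gradientP => e /H[t t0 Ht].
by exists t => // y Ay yt; rewrite dotpNl -!opprD normrN; exact: Ht.
Qed.

(** An upper bound on the difference quotients along [w] survives in the limit. The convexity and
    Lipschitz estimates below are instances. *)
Lemma is_gradient_le A h u v w c : is_gradient A h u v ->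
  (forall t, 0 < t < 1 -> A (u + t *: w) /\ h (u + t *: w) - h u <= t * c) ->
  dotp v w <= c.
Proof.
move=> /is_gradientP H hc; apply/ler_addgt0Pr => e e0.
have n1 : 0 < enorm w + 1 by rewrite ltr_wpDl// enorm_ge0.
have [s s0 Hs] := H _ (divr_gt0 e0 n1).
(* The step stays below 1 and moves [u] by less than [s]; the [+ 1] covers [w = 0]. *)
pose t := Num.min 2^-1 (s / 2 / (enorm w + 1)).
have t0 : 0 < t by rewrite lt_min invr_gt0 ltr0n !divr_gt0.
have t01 : 0 < t < 1.
  rewrite t0 gt_min; apply/orP; left.
  by rewrite invf_lt1// ltr1n.
have [At ht] := hc _ t01.
have tw : t * enorm w < s.
  apply: (@le_lt_trans _ _ (s / 2)); last by rewrite ltr_pdivrMr// ltr_pMr// ltr1n.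
  apply: (@le_trans _ _ (t * (enorm w + 1))).
    by rewrite ler_pM2l// lerDl.
  by rewrite -ler_pdivlMr// ge_min lexx orbT.
have := Hs _ At; rewrite [u + _ - u]addrC addKr enormZ dotpZr (gtr0_norm t0) => /(_ tw).
rewrite ler_norml => /andP[+ _].
have : e / (enorm w + 1) * (t * enorm w) <= e * t.
  by rewrite mulrCA [e * t]mulrC ler_pM2l// mulrAC ler_pdivrMr// ler_pM2l// lerDl.
move=> e1 e2.
have : t * dotp v w <= t * (c + e) by rewrite mulrDr; lra.
by rewrite ler_pM2l.
Qed.

Lemma is_gradient_convex_le A h u v y : is_gradient A h u v ->
  (forall t, 0 < t < 1 -> A (u + t *: (y - u)) /\
     h (u + t *: (y - u)) <= t * h y + (1 - t) * h u) ->
  dotp v (y - u) <= h y - h u.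
Proof.
move=> H hc; apply: is_gradient_le H _ => t /hc[At ht]; split => //.
by rewrite mulrBr; lra.
Qed.

Lemma is_gradient_lipschitz A h u v w c : is_gradient A h u v ->
  (forall t, 0 < t < 1 -> A (u + t *: w) /\ `|h (u + t *: w) - h u| <= t * c) ->
  `|dotp v w| <= c.
Proof.
move=> H hc; rewrite ler_norml lerNl -dotpNl; apply/andP; split.
  apply: is_gradient_le (is_gradientN _ _ _ _ H) _ => t /hc[At].
  by rewrite ler_norml => ht; split => //; lra.
by apply: is_gradient_le H _ => t /hc[At]; rewrite ler_norml => ht; split => //; lra.
Qed.

(** Serves to get measurability in the random parameter: directional derivatives become limits of a
    sequence of measurable quotients. *)
Lemma is_gradient_cvg A h u v w : is_gradient A h u v ->
  (forall t, 0 < t <= 1 -> A (u + t *: w)) ->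
  (fun n => n.+1%:R * (h (u + n.+1%:R^-1 *: w) - h u)) @ \oo --> dotp v w.
Proof.
move=> /is_gradientP H hA; apply/cvgrPdist_le => e e0.
have n1 : 0 < enorm w + 1 by rewrite ltr_wpDl// enorm_ge0.
have [s s0 Hs] := H _ (divr_gt0 e0 n1).
near=> n.
have n0 : 0 < n.+1%:R^-1 :> R by rewrite invr_gt0.
have nA : A (u + n.+1%:R^-1 *: w) by apply: hA; rewrite n0/= invf_le1// ler1n.
have ns : n.+1%:R^-1 * enorm w < s.
  rewrite mulrC ltr_pdivrMr// mulrC -ltr_pdivrMr//.
  apply: (@lt_trans _ _ n%:R); last by rewrite ltr_nat.
  by near: n; exact: nbhs_infty_gtr.
have := Hs _ nA; rewrite [u + _ - u]addrC addKr enormZ dotpZr (gtr0_norm n0) => /(_ ns).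
rewrite distrC => hn.
rewrite -(ler_pM2l n0) -[X in X * `|_|](gtr0_norm n0) -normrM mulrBr mulrA mulVf// mul1r.
rewrite (le_trans hn)// mulrCA ler_pM2l// mulrAC ler_pdivrMr// ler_pM2l//.
by rewrite lerDl.
Unshelve. all: by end_near. Qed.

End gradients.

(** * Level sets and quantiles of atomless losses *)

Section quantiles.
Context {R : realType} {dsp : measure_display} {T : measurableType dsp}.
Context (P : probability T R).
Implicit Types (Z : T -> R) (A B : set T).
Local Open Scope ereal_scope.

Lemma measurable_sublevel Z : measurable_fun setT Z ->
  forall y : R, measurable [set w | (Z w <= y)%R].
Proof.
move=> mZ y; rewrite [X in measurable X](_ : _ = setT `&` Z @^-1` `]-oo, y]).
  exact: mZ.
by apply/seteqP; split=> w; rewrite /= ?in_itv/=; [|case].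
Qed.

Lemma measurable_superlevel Z : measurable_fun setT Z ->
  forall y : R, measurable [set w | (y <= Z w)%R].
Proof.
move=> mZ y; rewrite [X in measurable X](_ : _ = setT `&` Z @^-1` `[y, +oo[).
  exact: mZ.
by apply/seteqP; split=> w; rewrite /= ?in_itv/= ?andbT; [|case].
Qed.

Lemma measurable_level Z : measurable_fun setT Z ->
  forall y : R, measurable [set w | Z w = y].
Proof.
by move=> mZ y; have := mZ measurableT _ (measurable_set1 y); rewrite setTI.
Qed.

Lemma measurable_near_level Z (M : T -> R) (y : R) : measurable_fun setT Z ->
  measurable_fun setT M -> measurable [set w | `|Z w - y| <= M w]%R.
Proof.
move=> mZ mM.
rewrite (_ : [set w | _] = [set w | `|Z w - y| - M w <= 0]%R); last first.
  by apply/seteqP; split=> w; rewrite /= subr_le0.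
apply: measurable_sublevel; apply: measurable_funB => //.
by apply: measurableT_comp => //; apply: measurable_funB.
Qed.

(** Without atoms the CDF is continuous, so at the quantile it equals [1 - a] exactly: right
    continuity gives one inequality, continuity from below the other. *)
Lemma VaR_atomless Z (a : R) : measurable_fun setT Z ->
  (forall y, P [set w | Z w = y] = 0) -> (0 < a < 1)%R ->
  exists2 y : R, VaR P a Z = y%:E & P [set w | (y <= Z w)%R] = a%:E.
Proof.
move=> mZ Z0 /andP[a0 a1].
have [X XE] : exists X : {RV P >-> R}, X = Z :> (T -> R).
  by exists (mfun_Sub (mem_set mZ)).
have FE y : P [set w | (Z w <= y)%R] = cdf X y.
  by rewrite /cdf /distribution /pushforward XE; congr (P _).
pose S := [set y : R | (1 - a)%:E <= P [set w | (Z w <= y)%R]].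
have S0 : S !=set0.
  have : \forall y \near +oo%R, (1 - a)%:E < cdf X y.
    have /(_ [set x | (1 - a)%:E < x]) := cvg_cdfy1 X; apply.
    apply: open_nbhs_nbhs; split; first exact: open_ereal_gt_ereal.
    by rewrite /= lte_fin gtrBl.
  move=> [M [_ MX]]; exists (M + 1)%R; rewrite /S/= FE ltW//.
  by apply: MX; rewrite ltrDl.
have lS : has_lbound S.
  have : \forall y \near -oo%R, cdf X y < (1 - a)%:E.
    have /(_ [set x | x < (1 - a)%:E]) := cvg_cdfNy0 X; apply.
    apply: open_nbhs_nbhs; split; first exact: open_ereal_lt_ereal.
    by rewrite /= lte_fin subr_gt0.
  move=> [M [_ MX]]; exists M => y; rewrite /S/= FE leNgt.
  by apply: contraNle => yM; apply: MX.
exists (inf S); first by rewrite /VaR ereal_inf_EFin.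
have ge : (1 - a)%:E <= cdf X (inf S).
  apply: (closed_cvg (fun x => (1 - a)%:E <= x) _ _ _ (@cdf_right_continuous _ _ _ P X (inf S))).
    exact: closed_ereal_le_ereal.
  near=> y.
  have : (inf S < y)%R by near: y; exact: nbhs_right_gt.
  move=> /(inf_lt S0)[s Ss sy].
  by rewrite (le_trans Ss)// FE; apply: cdf_nondecreasing; exact: ltW.
have ltM : measurable [set w | (Z w < inf S)%R].
  rewrite (_ : [set w | (Z w < inf S)%R] = ~` [set w | (inf S <= Z w)%R]).
    by apply: measurableC; exact: measurable_superlevel.
  by apply/seteqP; split=> w /=; rewrite ltNge => /negP.
have le : P [set w | (Z w < inf S)%R] <= (1 - a)%:E.
  (* These events increase to the strict sublevel, and each threshold, being below [inf S], lies
     outside [S]. *)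
  pose F n := [set w | (Z w <= inf S - n.+1%:R^-1)%R].
  have FU : \bigcup_n F n = [set w | (Z w < inf S)%R].
    apply/seteqP; split=> w /=.
      by move=> [n _]; rewrite /F/= => /le_lt_trans; apply; rewrite gtrBl.
    move=> wS; have d0 : (0 < inf S - Z w)%R by rewrite subr_gt0.
    exists (Num.truncn (inf S - Z w)^-1) => //; rewrite /F/=.
    rewrite lerBrDr addrC -lerBrDr invf_ple ?posrE// ltW//.
    exact: truncnS_gt.
  have PF : P (F n) @[n --> \oo] --> P (\bigcup_n F n).
    apply: nondecreasing_cvg_mu => [n||n m nm].
    - exact: measurable_sublevel.
    - by rewrite FU.
    - apply/subsetPset => w; rewrite /F/= => /le_trans; apply.
      by rewrite lerD2l lerN2 lef_pV2 ?posrE// ler_nat.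
  rewrite -FU; apply: (closed_cvg (fun x => x <= (1 - a)%:E) _ _ _ PF).
    exact: closed_ereal_ge_ereal.
  apply: nearW => n; rewrite leNgt; apply/negP => /ltW Sn.
  have := ge_inf lS Sn; rewrite leNgt => /negP; apply.
  by rewrite gtrBl.
have eq : P [set w | (Z w < inf S)%R] = cdf X (inf S).
  rewrite -FE (_ : [set w | (Z w <= inf S)%R] =
    [set w | (Z w < inf S)%R] `|` [set w | Z w = inf S]); last first.
    apply/seteqP; split=> w /=; first by rewrite le_eqVlt => /orP[/eqP|]; auto.
    by case=> [/ltW //|->].
  rewrite measureU//; [by rewrite [X in (_ + X)%R](Z0 (inf S)) adde0|exact: measurable_level|].
  by apply/seteqP; split=> w //= [/[swap] ->]; rewrite ltxx.
rewrite (_ : [set w | (inf S <= Z w)%R] = ~` [set w | (Z w < inf S)%R]).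
  rewrite probability_setC// (_ : P _ = (1 - a)%:E).
    by rewrite -EFinB; congr (_%:E); lra.
  by apply/eqP; rewrite eq_le le eq ge.
by apply/seteqP; split=> w /=; rewrite leNgt => /negP.
Unshelve. all: by end_near. Qed.

End quantiles.

(** * Tail events and the stability of integrals over them *)

Section tail_events.
Context {R : realType} {dsp : measure_display} {T : measurableType dsp}.
Context (P : probability T R).
Implicit Types (Z M : T -> R) (A B : set T).

Lemma integrable_dominated A (f g : T -> R) : measurable A -> measurable_fun A f ->
  P.-integrable A (EFin \o g) -> (forall w, A w -> `|f w| <= g w) ->
  P.-integrable A (EFin \o f).
Proof.
move=> mA mf ig fg; apply: le_integrable ig => //; first exact/measurable_EFinP.
by move=> w Aw; rewrite /= lee_fin (le_trans (fg _ Aw))// ler_norm.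
Qed.

(** A difference of extended reals is finite only if both terms are, so the positive and negative
    parts have finite integrals. *)
Lemma integral_fin_num_integrable A (f : T -> \bar R) : measurable A ->
  measurable_fun A f -> (\int[P]_(w in A) f w)%E \is a fin_num ->
  P.-integrable A f.
Proof.
move=> mA mf; rewrite integralE fin_numB => /andP[fp fn].
apply/integrableP; split=> //.
under eq_integral do rewrite -/((abse \o f) _) fune_abse.
rewrite ge0_integralD//; last 2 first.
- exact: measurable_funepos.
- exact: measurable_funeneg.
by rewrite lte_add_pinfty// ltey_eq ?fp ?fn.
Qed.

(* [A = setT] is the case [a = 1], where VaR is [-oo]; then [y] is irrelevant. *)
Definition tail_event (a : R) Z A (y : R) :=
  [/\ measurable A, P A = a%:E, P.-integrable A (EFin \o Z) &
      A = setT \/ A = [set w | y <= Z w]].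

(** The event in the definition of CVaR has probability exactly [a]: it is everything when [a = 1],
    and otherwise the superlevel set at the quantile. *)
Lemma CVaR_tail Z (a : R) : measurable_fun setT Z ->
  (forall y, P [set w | Z w = y] = 0%E) -> 0 < a <= 1 ->
  CVaR P a Z \is a fin_num ->
  exists A y, tail_event a Z A y /\ a * fine (CVaR P a Z) = \int[P]_(w in A) Z w.
Proof.
move=> mZ Z0 /andP[a0 a1] fZ.
have [A [y [mA PA AE AV]]] : exists A y, [/\ measurable A, P A = a%:E,
    A = setT \/ A = [set w | y <= Z w] & A = [set w | (VaR P a Z <= (Z w)%:E)%E]].
  move: a1; rewrite le_eqVlt => /predU1P[a1|a1].
    exists setT, 0; split=> //; rewrite ?a1 ?probability_setT//; first by left.
    apply/esym/seteqP; split=> w //= _.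
    rewrite (_ : VaR _ _ _ = -oo%E) ?leNye// /VaR -[RHS]ereal_inf_real; congr ereal_inf.
    apply/seteqP; split=> _ [z _ <-]; exists z => //=.
    by rewrite subrr.
  have a01 : 0 < a < 1 by rewrite a0.
  have [y yE Py] := VaR_atomless P _ _ mZ Z0 a01.
  exists [set w | y <= Z w], y; split=> //; [exact: measurable_superlevel|by right|].
  by apply/seteqP; split=> w; rewrite /= yE lee_fin.
move: fZ; rewrite /CVaR -AV PA /= => fZ.
(* An infinite integral would stay infinite after scaling by the positive [a^-1]. *)
have fI : (\int[P]_(w in A) (Z w)%:E)%E \is a fin_num.
  move: fZ; case: (\int[P]_(w in A) _)%E => //.
    by rewrite gt0_muley ?lte_fin ?invr_gt0.
  by rewrite gt0_muleNy ?lte_fin ?invr_gt0.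
have iA : P.-integrable A (EFin \o Z).
  apply: integral_fin_num_integrable => //; apply/measurable_EFinP.
  exact: measurable_funTS.
exists A, y; split=> //.
by rewrite fineM//= mulrA divff ?mul1r// gt_eqF.
Qed.

(** Here [b] stands for membership in a competing event. If [z0] is farther than [m] from [y], then
    [z1] is on the same side of [y] and selecting by [z0] is already optimal; otherwise a wrong
    choice costs at most [m]. *)
Lemma tail_gap (b : bool) (z0 z1 m y : R) : `|z1 - z0| <= m ->
  (if b then z1 - y else 0) - (if y <= z0 then z1 - y else 0) <=
    if `|z0 - y| <= m then m else 0.
Proof.
rewrite !ler_norml => /andP[m1 m2].
case: b; case: (leP y z0) => yZ;
  (case: ifP => [/andP[s1 s2]|/negbT]; [|rewrite negb_and -!ltNge => /orP[] s]);
  lra.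
Qed.

(* A point of [A] outside [B], or of [B] outside [A], contributes to the left-hand
   side a positive amount only if [y] lies between its values under [Z0] and [Z1]. *)
Lemma tail_event_perturb (a : R) Z0 Z1 M A B y : tail_event a Z0 A y ->
  measurable_fun setT Z0 -> P.-integrable setT (EFin \o M) ->
  (forall w, `|Z1 w - Z0 w| <= M w) ->
  measurable B -> P B = a%:E ->
  P.-integrable A (EFin \o Z1) -> P.-integrable B (EFin \o Z1) ->
  \int[P]_(w in B) Z1 w - \int[P]_(w in A) Z1 w <=
    \int[P]_(w in [set w | `|Z0 w - y| <= M w]) M w.
Proof.
move=> [mA PA iA AE] mZ0 iM Z01 mB PB iA1 iB1.
have M0 w : 0 <= M w by exact: le_trans (Z01 w).
case: AE => AE.
  (* When [A] is everything, [B] has a null complement and the left-hand side vanishes. *)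
  have PT : P B = 1%E by rewrite PB -PA AE probability_setT.
  have PC : P (~` B) = 0%E by rewrite probability_setC// PT subee.
  rewrite AE -[X in - \int[P]_(w in X) _](setUv B) Rintegral_setU//.
  - rewrite opprD addrA subrr add0r /Rintegral null_set_integral//.
    + by rewrite oppr0 Rintegral_ge0.
    + exact: measurableC.
    + by apply: measurable_funTS; rewrite -AE; exact: measurable_int iA1.
  - exact: measurableC.
  - by rewrite setUv -AE.
  - by apply/disj_set2P; rewrite setICr.
have mM : measurable_fun setT M by apply/measurable_EFinP; exact: measurable_int iM.
set S := [set w | _].
have mS : measurable S by exact: measurable_near_level.
(* Both events have probability [a], so subtracting [y] from the integrand changes both integrals
   equally and leaves a pointwise comparison. *)
have shift C : measurable C -> P C = a%:E -> P.-integrable C (EFin \o Z1) ->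
    \int[P]_(w in C) Z1 w = \int[P]_w ((fun w => Z1 w - y) \_ C) w + y * a.
  move=> mC PC iC; rewrite -Rintegral_mkcond.
  rewrite RintegralB//; last exact: (finite_measure_integrable_cst P y mC).
  by rewrite Rintegral_cst// [X in fine X]PC subrK.
have ipatch C (f : T -> R) : measurable C -> P.-integrable C (EFin \o f) ->
    P.-integrable setT (EFin \o (f \_ C)).
  move=> mC /(integrable_mkcond _ mC); apply: eq_integrable => // w _.
  by rewrite /patch /=; case: ifP.
have iy C : measurable C -> P.-integrable C (EFin \o Z1) ->
    P.-integrable setT (EFin \o ((fun w => Z1 w - y) \_ C)).
  move=> mC iC; apply: ipatch => //.
  exact: (integrableB mC iC (finite_measure_integrable_cst P y mC)).
rewrite (shift B)// (shift A)// opprD addrACA subrr addr0 -RintegralB//; last 2 first.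
- exact: iy.
- exact: iy.
rewrite [leRHS]Rintegral_mkcond; apply: le_Rintegral => //.
- exact: (integrableB measurableT (iy _ mB iB1) (iy _ mA iA1)).
- by apply: ipatch => //; exact: integrableS iM.
move=> w _; rewrite /patch; have := Z01 w; have := M0 w.
have -> : (w \in S) = (`|Z0 w - y| <= M w).
  by apply/idP/idP; [rewrite inE|move=> ?; rewrite inE].
have -> : (w \in A) = (y <= Z0 w).
  by rewrite AE; apply/idP/idP; [rewrite inE|move=> ?; rewrite inE].
by move=> _; exact: tail_gap.
Qed.

End tail_events.

(** * Convexity of CVaR and its first-order perturbation *)

Section CVaR_inequalities.
Context {R : realType} {dsp : measure_display} {T : measurableType dsp}.
Context (P : probability T R).
Implicit Types (Z M : T -> R) (A B : set T).

Definition regular_loss (a : R) Z :=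
  [/\ measurable_fun setT Z, forall y, P [set w | Z w = y] = 0%E &
      CVaR P a Z \is a fin_num].

(** The perturbation estimate with [M = 0], whose error integral is zero. *)
Lemma tail_event_max (a : R) Z A B y : tail_event P a Z A y ->
  measurable_fun setT Z -> measurable B -> P B = a%:E ->
  P.-integrable B (EFin \o Z) ->
  \int[P]_(w in B) Z w <= \int[P]_(w in A) Z w.
Proof.
move=> tA mZ mB PB iB; have [_ _ iA _] := tA.
have := tail_event_perturb P a Z Z (cst 0) A B y tA mZ
  (finite_measure_integrable_cst P 0 measurableT).
rewrite Rintegral_cst; last first.
  rewrite (_ : [set w | _] = [set w | Z w = y]); first exact: measurable_level.
  apply/seteqP; split=> w /=; rewrite normr_le0 subr_eq0; first by move/eqP.
  by move->.
rewrite mul0r subr_le0; apply=> // w.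
by rewrite subrr normr0.
Qed.

(** Off the tail event the positive part is at most [|y|]. This controls [Z] from above on the tail
    events of other losses. *)
Lemma tail_event_integrable_pos (a : R) Z A y : tail_event P a Z A y ->
  measurable_fun setT Z -> P.-integrable setT (EFin \o (fun w => Num.max (Z w) 0)).
Proof.
move=> [mA PA iA AE] mZ.
have mp : measurable_fun setT (fun w => Num.max (Z w) 0).
  by apply: measurable_maxr.
case: AE => AE.
  rewrite AE in iA; apply: integrable_dominated (integrable_norm iA) _ => //.
  by move=> w _ /=; case: (leP (Z w) 0) => ?; rewrite ?normr0.
have ip : P.-integrable setT (EFin \o ((fun w => `|Z w|) \_ A)).
  have := integrable_norm iA => /(integrable_mkcond _ mA).
  by apply: eq_integrable => // w _; rewrite /patch /=; case: ifP.
have iy := finite_measure_integrable_cst P `|y| measurableT.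
apply: integrable_dominated (integrableD measurableT ip iy) _ => //.
move=> w _; rewrite /= /patch; case: ifP => [_|/negbT].
  by case: (leP (Z w) 0) => ?; rewrite ?normr0 ?addr_ge0// lerDl.
rewrite AE notin_setE/= => /negP; rewrite -ltNge => Zy.
(* Outside [A] the patched function takes the default value [point], which is 0. *)
rewrite (_ : point = 0 :> R)// add0r.
case: (leP (Z w) 0) => Z0; rewrite ?normr0//.
by have y0 := lt_trans Z0 Zy; rewrite !gtr0_norm//; exact: ltW.
Qed.

Lemma CVaR_convex_bound (t s c z z1 z2 : R) : 0 < t -> 0 < s -> t + s = 1 ->
  z <= t * z1 + s * z2 + c ->
  t * `|z1| <= `|z| + Num.max z1 0 + Num.max z2 0 + `|c|.
Proof.
move=> t0 s0 ts zle; have := ler_norm c; have := ler_norm (- z); rewrite normrN.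
have := normr_ge0 c; have := normr_ge0 z.
move=> n0 e0 zn ce.
have m1 : 0 <= Num.max z2 0 by rewrite le_max lexx orbT.
have m2 : s * z2 <= Num.max z2 0.
  have [z20|z20] := leP z2 0; first by rewrite pmulr_rle0.
  by rewrite ger_pMl//; lra.
have [z10|z10] := leP z1 0; first by rewrite (ler0_norm z10); lra.
have : s * z1 >= 0 by rewrite mulr_ge0// ltW.
have -> : s = 1 - t by lra.
by rewrite (gtr0_norm z10); lra.
Qed.

(** All three losses are integrated over the tail event of [Z]. The constant [c] lets one inequality
    cover convexity and translation together. *)
Lemma CVaR_convex (a t c : R) Z Z1 Z2 : 0 < a <= 1 -> 0 < t < 1 ->
  regular_loss a Z -> regular_loss a Z1 -> regular_loss a Z2 ->
  (forall w, Z w <= t * Z1 w + (1 - t) * Z2 w + c) ->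
  fine (CVaR P a Z) <= t * fine (CVaR P a Z1) + (1 - t) * fine (CVaR P a Z2) + c.
Proof.
move=> a01 /andP[t0 t1] [mZ Z0 fZ] [mZ1 Z10 fZ1] [mZ2 Z20 fZ2] Zle.
have a0 : 0 < a by case/andP: a01.
have [A [y [tA CA]]] := CVaR_tail P _ _ mZ Z0 a01 fZ.
have [A1 [y1 [tA1 CA1]]] := CVaR_tail P _ _ mZ1 Z10 a01 fZ1.
have [A2 [y2 [tA2 CA2]]] := CVaR_tail P _ _ mZ2 Z20 a01 fZ2.
have [mA PA iA _] := tA.
have i1 := integrableS measurableT mA (@subsetT _ _) (tail_event_integrable_pos _ _ _ _ tA1 mZ1).
have i2 := integrableS measurableT mA (@subsetT _ _) (tail_event_integrable_pos _ _ _ _ tA2 mZ2).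
have ic := finite_measure_integrable_cst P `|c| mA.
have iN := integrable_norm iA.
have iZ (s : R) (f : T -> R) : P.-integrable A (EFin \o f) ->
    P.-integrable A (EFin \o (fun w => s * f w)) by exact: integrableZl.
(* [Z1] is bounded below on [A] by [Z] and the positive part of [Z2]. *)
have iB : P.-integrable A (EFin \o (fun w => `|Z w| + Num.max (Z1 w) 0 + Num.max (Z2 w) 0 + `|c|)).
  exact: (integrableD mA (integrableD mA (integrableD mA iN i1) i2) ic).
have s0 : 0 < 1 - t by rewrite subr_gt0.
have tV : 1 <= t^-1 by rewrite invf_ge1// ltW.
have sV : 1 <= (1 - t)^-1 by rewrite invf_ge1//; lra.
have iA1 : P.-integrable A (EFin \o Z1).
  apply: integrable_dominated (iZ t^-1 _ iB) _ => //; first exact: measurable_funTS.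
  move=> w _ /=; rewrite ler_pdivlMl//.
  by apply: CVaR_convex_bound (Zle w) => //; rewrite addrC subrK.
have iA2 : P.-integrable A (EFin \o Z2).
  apply: integrable_dominated (iZ (1 - t)^-1 _ iB) _ => //; first exact: measurable_funTS.
  move=> w _ /=; rewrite ler_pdivlMl//.
  rewrite (addrAC `|Z w|); apply: (CVaR_convex_bound _ t) => //.
    by rewrite subrK.
  by rewrite [X in X + _]addrC.
have := tail_event_max _ _ _ _ _ tA1 mZ1 mA PA iA1; rewrite -CA1 => H1.
have := tail_event_max _ _ _ _ _ tA2 mZ2 mA PA iA2; rewrite -CA2 => H2.
have : \int[P]_(w in A) Z w <= \int[P]_(w in A) (t * Z1 w + (1 - t) * Z2 w + c).
  apply: le_Rintegral => //.
  exact: (integrableD mA (integrableD mA (iZ _ _ iA1) (iZ _ _ iA2))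
    (finite_measure_integrable_cst P c mA)).
rewrite RintegralD//; last 2 first.
- exact: (integrableD mA (iZ _ _ iA1) (iZ _ _ iA2)).
- exact: (finite_measure_integrable_cst P c mA).
rewrite RintegralD//; [|exact: iZ..].
rewrite !RintegralZl// Rintegral_cst// [X in fine X]PA -CA /= => H.
have H3 := ler_wpM2l (ltW t0) H1; have H4 := ler_wpM2l (ltW s0) H2.
by rewrite -(ler_pM2l a0) !mulrDr !(mulrCA a) [a * c]mulrC; lra.
Qed.

(** The quantity inside the absolute value is the integral of [Z1] over its own tail event minus
    that over [A]: nonnegative by maximality, and bounded above by the perturbation estimate. *)
Lemma CVaR_perturb (a : R) Z0 Z1 M A y : 0 < a <= 1 ->
  tail_event P a Z0 A y -> a * fine (CVaR P a Z0) = \int[P]_(w in A) Z0 w ->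
  measurable_fun setT Z0 -> regular_loss a Z1 -> P.-integrable setT (EFin \o M) ->
  (forall w, `|Z1 w - Z0 w| <= M w) ->
  `|a * (fine (CVaR P a Z1) - fine (CVaR P a Z0)) - \int[P]_(w in A) (Z1 w - Z0 w)|
    <= \int[P]_(w in [set w | `|Z0 w - y| <= M w]) M w.
Proof.
move=> a01 tA CA mZ0 [mZ1 Z10 fZ1] iM Z01.
have [A1 [y1 [tA1 CA1]]] := CVaR_tail P _ _ mZ1 Z10 a01 fZ1.
have [mA PA iA _] := tA; have [mA1 PA1 iA1 _] := tA1.
have iD : P.-integrable A (EFin \o (fun w => Z1 w - Z0 w)).
  apply: integrable_dominated (integrableS measurableT mA (@subsetT _ _) iM) _ => //.
  by apply: measurable_funTS; exact: measurable_funB.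
have i1 : P.-integrable A (EFin \o Z1).
  have := integrableD mA iA iD; apply: eq_integrable => // w _ /=.
  by rewrite -EFinD addrC subrK.
rewrite mulrBr CA CA1 RintegralB// opprB addrA subrK.
rewrite ger0_norm ?subr_ge0; last exact: tail_event_max tA1 _ _ _ _.
exact: tail_event_perturb tA _ _ _ _ _ _ _.
Qed.

End CVaR_inequalities.

(** * Dominated convergence and finite sums for real-valued integrals *)

Section integrals.
Context {R : realType} {dsp : measure_display} {T : measurableType dsp}.
Context (P : probability T R).

Lemma Rintegral_dominated_cvg0 (r : nat -> T -> R) (G : T -> R) (N : set T) :
  (forall n, measurable_fun setT (r n)) -> P.-integrable setT (EFin \o G) ->
  (forall n w, `|r n w| <= G w) -> measurable N -> P N = 0%E ->
  (forall w, ~ N w -> r ^~ w @ \oo --> 0) ->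
  (fun n => \int[P]_w r n w) @ \oo --> 0.
Proof.
move=> mr iG rG mN N0 r0.
have [||||] := @dominated_convergence _ _ _ P setT measurableT
  (fun n w => (r n w)%:E) (cst 0%E) (EFin \o G) _ _ _ iG.
- by move=> n; exact/measurable_EFinP.
- exact: measurable_cst.
- exists N; split=> // w /= H; apply: contrapT => Nw; apply: H => _.
  by apply: cvg_EFin; [exact: nearW|exact: r0].
- by apply: aeW => w n _; rewrite /= lee_fin.
move=> _ _; rewrite integral0; exact: fine_cvg.
Qed.

Lemma integrable_Rsum (I : Type) (s : seq I) (A : set T) (f : I -> T -> R) :
  measurable A -> (forall i, P.-integrable A (EFin \o f i)) ->
  P.-integrable A (EFin \o (fun w => \sum_(i <- s) f i w)).
Proof.
move=> mA fi; elim: s => [|i s IH].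
  by apply: eq_integrable (integrable0 P A) => // w _ /=; rewrite big_nil.
apply: eq_integrable (integrableD mA (fi i) IH) => // w _ /=.
by rewrite big_cons.
Qed.

Lemma Rintegral_sum (I : Type) (s : seq I) (A : set T) (f : I -> T -> R) :
  measurable A -> (forall i, P.-integrable A (EFin \o f i)) ->
  \int[P]_(w in A) (\sum_(i <- s) f i w) = \sum_(i <- s) \int[P]_(w in A) f i w.
Proof.
move=> mA fi; elim: s => [|i s IH].
  rewrite big_nil; under eq_Rintegral do rewrite big_nil.
  by rewrite Rintegral_cst// mul0r.
rewrite big_cons -IH -RintegralD//; last exact: integrable_Rsum.
by apply: eq_Rintegral => w _; rewrite big_cons.
Qed.

Lemma Rintegral_ge0_le_setT (A : set T) (f : T -> R) : measurable A ->
  P.-integrable setT (EFin \o f) -> (forall w, 0 <= f w) ->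
  \int[P]_(w in A) f w <= \int[P]_w f w.
Proof.
move=> mA fi f0; rewrite [leLHS]Rintegral_mkcond; apply: le_Rintegral => //.
  have := integrableS measurableT mA (@subsetT _ _) fi => /(integrable_mkcond _ mA).
  by apply: eq_integrable => // w _; rewrite /patch /=; case: ifP.
by move=> w _; rewrite /patch; case: ifP.
Qed.

End integrals.

(** * Finite spanning families and coordinates *)

Section spanning.
Context {R : realType}.

(** Take rows from [W] of maximal rank; appending another vector of [W] cannot raise the rank, so it
    already lies in the row space. *)
Lemma spanning_rows {F : fieldType} {d : nat} (W : set 'rV[F]_d) :
  exists r (B : 'M[F]_(r, d)), (forall j, W (row j B)) /\
    forall w, W w -> (w <= B)%MS.
Proof.
pose Q k := `[< exists r (B : 'M[F]_(r, d)), (forall j, W (row j B)) /\ \rank B = k >].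
have Q0 : exists k, Q k.
  exists 0%N; apply/asboolP; exists 0%N, 0; split; last by rewrite mxrank0.
  by case.
have Qd k : Q k -> (k <= d)%N by move=> /asboolP[r [B [_ <-]]]; exact: rank_leq_col.
case: (ex_maxnP Q0 Qd) => k /asboolP[r [B [WB Bk]]] kmax.
exists r, B; split=> // w Ww.
have := mxrank_leqif_sup (B := col_mx B w) (A := B).
rewrite col_mx_sub submx_refl /=; move=> <-; last first.
  by rewrite -addsmxE addsmxSl.
rewrite eqn_leq mxrankS ?Bk /=; last by rewrite -addsmxE addsmxSl.
apply: kmax; apply/asboolP; exists (r + 1)%N, (col_mx B w); split=> // j.
by case: (split_ordP j) => i ->; rewrite ?rowKu ?rowKd// row_id.
Qed.

Lemma dotp_rV {d : nat} (u v : 'rV[R]_d) : dotp u v = (v *m u^T) 0 0.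
Proof.
by rewrite /dotp big_ord1 !mxE; apply: eq_bigr => j _; rewrite mxE mulrC.
Qed.

Lemma dotp_spanning {d r : nat} (B : 'M[R]_(r, d)) (u w : 'rV[R]_d) : (w <= B)%MS ->
  dotp u w = \sum_j (w *m pinvmx B) 0 j * dotp u (row j B).
Proof.
move=> wB; rewrite dotp_rV -[in LHS](mulmxKpV wB) -(mulmxA (w *m _)) mxE.
by apply: eq_bigr => j _; rewrite dotp_rV -row_mul !mxE.
Qed.

End spanning.

(** * Differentiability of CVaR along a family of losses *)

Section CVaR_differentiability.
Context {R : realType} {dsp : measure_display} {T : measurableType dsp}.
Context (P : probability T R).

(* The gradients of [h^~ w] at [u] need not be unique, nor chosen measurably in [w]:
   only their inner products with [y - u], which are limits of difference
   quotients, are integrated, for finitely many [y] such that the [y - u] span. *)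
Lemma CVaR_differentiable {d : nat} (a : R) (X : set 'rV[R]_d)
    (h : 'rV[R]_d -> T -> R) (L : T -> R) (u : 'rV[R]_d) :
  0 < a <= 1 -> X u ->
  (forall y t, X y -> 0 < t <= 1 -> X (u + t *: (y - u))) ->
  (forall y, X y -> regular_loss P a (h y)) ->
  P.-integrable setT (EFin \o L) ->
  (forall w y z, X y -> X z -> `|h y w - h z w| <= L w * enorm (y - z)) ->
  (forall w, exists v, is_gradient X (h^~ w) u v) ->
  exists v, is_gradient X (fun y => fine (CVaR P a (h y))) u v.
Proof.
move=> a01 Xu Xstar hreg iL hL /choice[v hv].
have a0 : 0 < a by case/andP: a01.
have mL : measurable_fun setT L by apply/measurable_EFinP; exact: measurable_int iL.
have mh y : X y -> measurable_fun setT (h y) by move=> /hreg[].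
have [_ hu0 fu] := hreg _ Xu.
have [A [q [tA CA]]] := CVaR_tail P _ _ (mh _ Xu) hu0 a01 fu.
have [mA PA _ _] := tA.
have vL w y : X y -> `|dotp (v w) (y - u)| <= L w * enorm (y - u).
  move=> Xy; apply: is_gradient_lipschitz (hv w) _ => t /andP[t0 t1].
  have Xt : X (u + t *: (y - u)) by apply: Xstar => //; rewrite t0 ltW.
  split=> //; have := hL w _ _ Xt Xu.
  by rewrite [u + _ - u]addrC addKr enormZ (gtr0_norm t0) mulrCA.
have mv y : X y -> measurable_fun setT (fun w => dotp (v w) (y - u)).
  move=> Xy; apply: (@measurable_fun_cvg _ _ _ _
      (fun n w => n.+1%:R * (h (u + n.+1%:R^-1 *: (y - u)) w - h u w))) => [n|w _].
    apply: measurable_funM => //; apply: measurable_funB; last exact: mh.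
    by apply: mh; apply: Xstar => //; rewrite invr_gt0 ltr0n/= invf_le1// ler1n.
  by apply: is_gradient_cvg (hv w) _ => t t01; exact: Xstar.
have iLr (r : R) : P.-integrable setT (EFin \o (fun w => L w * r)).
  exact: (integrableZr measurableT r iL).
have iv y : X y -> P.-integrable setT (EFin \o (fun w => dotp (v w) (y - u))).
  move=> Xy; apply: integrable_dominated (iLr (enorm (y - u))) _ => //; first exact: mv.
  by move=> w _; exact: vL.
have ih y : X y -> P.-integrable setT (EFin \o (fun w => h y w - h u w)).
  move=> Xy; apply: integrable_dominated (iLr (enorm (y - u))) _ => //.
    by apply: measurable_funB; exact: mh.
  by move=> w _; exact: hL.
have [r [B [XB sB]]] := spanning_rows [set b | exists2 y, X y & b = y - u].
pose e j := \int[P]_(w in A) dotp (v w) (row j B).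
(* Expanding [y - u] in the rows of [B] through [pinvmx B], [V] assigns to it the same combination
   of the tail averages [a^-1 * e j]. *)
pose V := (pinvmx B *m \col_j (a^-1 * e j))^T.
have VE y : X y -> a * dotp V (y - u) = \int[P]_(w in A) dotp (v w) (y - u).
  move=> Xy; have yB : (y - u <= B)%MS by apply: sB; exists y.
  transitivity (\int[P]_(w in A) \sum_j ((y - u) *m pinvmx B) 0 j * dotp (v w) (row j B)).
    have iB j : P.-integrable A (EFin \o (fun w => dotp (v w) (row j B))).
      by have [z Xz ->] := XB j; apply: integrableS (iv _ Xz).
    rewrite Rintegral_sum//; last by move=> j; exact: (integrableZl mA _ (iB j)).
    rewrite dotp_rV /V trmxK mulmxA mxE mulr_sumr; apply: eq_bigr => j _.
    by rewrite RintegralZl// mulrCA [X in a * X]mxE [a * _]mulrA divff ?mul1r// gt_eqF.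
  by apply: eq_Rintegral => w _; rewrite -dotp_spanning.
(* Dominated convergence works along sequences, so a failure of differentiability is turned into
   points [y n] tending to [u] that all violate the bound with [c]. *)
exists V; apply/is_gradientP => c c0; apply: contrapT => Hno.
have {Hno} /choice[y Hy] n : exists y, [/\ X y, enorm (y - u) < n.+1%:R^-1 &
    c * enorm (y - u) <
      `|fine (CVaR P a (h y)) - fine (CVaR P a (h u)) - dotp V (y - u)|].
  apply: contrapT => Hn; apply: Hno; exists n.+1%:R^-1; first by rewrite invr_gt0.
  move=> y Xy yn; rewrite leNgt; apply/negP => yc.
  by apply: Hn; exists y; split.
have Xy n : X (y n) by have [] := Hy n.
pose rho n := enorm (y n - u).
have rho0 n : 0 < rho n.
  rewrite lt_neqAle enorm_ge0 andbT; apply/eqP => yn.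
  have yu : y n - u = 0 by apply: enorm_eq0.
  have [_ _] := Hy n; rewrite yu enorm0 mulr0 dotp0r subr0 (subr0_eq yu) subrr.
  by rewrite normr0 ltxx.
(* The Lipschitz bound between the distinct points [y 0] and [u] forces the sign. *)
have L0 w : 0 <= L w.
  by have := le_trans (normr_ge0 _) (hL w _ _ (Xy 0%N) Xu); rewrite pmulr_lge0 ?rho0.
pose S n := [set w | `|h u w - q| <= L w * rho n].
pose D n w := h (y n) w - h u w - dotp (v w) (y n - u).
(* Sum of the two errors per unit displacement: the change of tail event near the quantile [q], and
   the linearization of [h]. Its integral will be at least [c * a] for every [n], yet tend to 0. *)
pose s n w := (if `|h u w - q| <= L w * rho n then L w else 0) + (rho n)^-1 * `|D n w|.
have mS n : measurable (S n).
  by apply: measurable_near_level; [exact: mh|exact: measurable_funM].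
have mD n : measurable_fun setT (D n).
  by apply: measurable_funB; [apply: measurable_funB; exact: mh|exact: mv].
have iD n : P.-integrable setT (EFin \o D n).
  exact: (integrableB measurableT (ih _ (Xy n)) (iv _ (Xy n))).
have iDn n : P.-integrable setT (EFin \o (fun w => `|D n w|)).
  exact: integrable_norm (iD n).
have ms n : measurable_fun setT (s n).
  apply: measurable_funD.
    apply: measurable_fun_ifT => //.
    apply: measurable_fun_ler; last exact: measurable_funM.
    by apply: measurableT_comp => //; apply: measurable_funB => //; exact: mh.
  by apply: measurable_funM => //; apply: measurableT_comp.
(* One [L] comes from the quantile term, one from the difference quotient and one from the
   gradient. *)
have sL n w : `|s n w| <= L w * 3.
  have Dn : (rho n)^-1 * `|D n w| <= L w + L w.
    rewrite ler_pdivrMl// (le_trans (ler_normB _ _))// mulrC mulrDl.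
    by rewrite lerD ?vL ?hL.
  rewrite ger0_norm; first by rewrite /s; case: ifP => _; have := L0 w; lra.
  rewrite /s addr_ge0//; first by case: ifP.
  by rewrite mulr_ge0// invr_ge0 ltW.
have sle n : c * a <= \int[P]_w s n w.
  have [_ _ cn] := Hy n.
  have := CVaR_perturb P a (h u) (h (y n)) (fun w => L w * rho n) A q a01 tA CA
    (mh _ Xu) (hreg _ (Xy n)) (iLr _) (fun w => hL w _ _ (Xy n) Xu).
  set C1 := fine (CVaR P a (h (y n))); set C0 := fine (CVaR P a (h u)).
  set I1 := \int[P]_(w in A) _; set I2 := \int[P]_(w in _) _ => pert.
  have gradE : `|I1 - a * dotp V (y n - u)| <= \int[P]_w `|D n w|.
    rewrite VE// -RintegralB//; last 2 first.
    - by apply: integrableS (ih _ (Xy n)).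
    - by apply: integrableS (iv _ (Xy n)).
    apply: le_trans (le_normr_Rintegral _ _) _ => //.
      by apply: integrableS (iD n).
    by apply: (Rintegral_ge0_le_setT P A (fun w => `|D n w|)).
  have S2 : I2 = rho n * \int[P]_w (if `|h u w - q| <= L w * rho n then L w else 0).
    rewrite /I2 RintegralZr//; [|exact: mS|exact: integrableS measurableT (mS n) (@subsetT _ _) iL].
    rewrite mulrC; congr (_ * _); rewrite Rintegral_mkcond; apply: eq_Rintegral => w _.
    rewrite /patch; have [w1|w1] := boolP (_ <= _); first by rewrite mem_set.
    by rewrite memNset//= => /= w2; rewrite w2 in w1.
  have ifi : P.-integrable setT
      (EFin \o (fun w => if `|h u w - q| <= L w * rho n then L w else 0)).
    apply: integrable_dominated iL _ => //.
      apply: measurable_fun_ifT => //.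
      apply: measurable_fun_ler; last exact: measurable_funM.
      by apply: measurableT_comp => //; apply: measurable_funB => //; exact: mh.
    by move=> w _; case: ifP => _; rewrite ?normr0// ger0_norm.
  rewrite /s RintegralD//; last exact: (integrableZl measurableT _ (iDn n)).
  rewrite RintegralZl// -(ler_pM2l (rho0 n)) mulrDr mulVKf ?gt_eqF// -S2.
  have cn' : c * rho n * a <= `|a * (C1 - C0 - dotp V (y n - u))|.
    by rewrite normrM (gtr0_norm a0) mulrC ler_pM2l// ltW.
  rewrite mulrCA mulrA; apply: le_trans cn' _.
  rewrite (_ : a * _ = (a * (C1 - C0) - I1) + (I1 - a * dotp V (y n - u))); last by lra.
  by rewrite (le_trans (ler_normD _ _))// lerD.
have lim0 : (fun n => \int[P]_w s n w) @ \oo --> 0.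
  (* The excluded level set is null because [h u] has no atom; off it the quantile term is
     eventually zero. *)
  apply: (Rintegral_dominated_cvg0 P s (fun w => L w * 3) [set w | h u w = q]) => //.
    by apply: measurable_level; exact: mh.
  move=> w /eqP hq; rewrite -[0]addr0; apply: cvgD.
    have d0 : 0 < `|h u w - q| / (L w + 1).
      by rewrite divr_gt0 ?ltr_wpDl// normr_gt0 subr_eq0.
    apply: cvg_near_cst; near=> n; rewrite ifF//; apply/negbTE; rewrite -ltNge.
    apply: (@le_lt_trans _ _ ((L w + 1) * rho n)).
      by rewrite ler_pM2r// lerDl.
    rewrite mulrC -ltr_pdivlMr ?ltr_wpDl//.
    have [_ yn _] := Hy n; apply: lt_trans yn _.
    by near: n; exact: near_infty_natSinv_lt (PosNum d0).
  apply/cvgrPdist_le => eps eps0; have /is_gradientP/(_ _ eps0)[t t0 Ht] := hv w.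
  near=> n; rewrite sub0r normrN ger0_norm; last by rewrite mulr_ge0// invr_ge0 ltW.
  rewrite ler_pdivrMl// mulrC; apply: Ht => //.
  have [_ yn _] := Hy n; apply: lt_trans yn _.
  by near: n; exact: near_infty_natSinv_lt (PosNum t0).
have ca : 0 < c * a by rewrite mulr_gt0.
have /cvgrPdist_lt/(_ _ ca)[n _ /(_ n (leqnn n))] := lim0.
rewrite sub0r normrN => sn.
by have := le_lt_trans (le_trans (sle n) (ler_norm _)) sn; rewrite ltxx.
Unshelve. all: by end_near. Qed.

End CVaR_differentiability.

(** * Segments in convex sets, unilateral deviations, and the game itself *)

Section games.
Context {R : realType}.

Lemma abs_cont_atomless {dsp : measure_display} {T : measurableType dsp}
    (P : probability T R) (Z : T -> R) (y : R) :
  pushforward P Z `<< @lebesgue_measure R -> P [set w | Z w = y] = 0%E.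
Proof.
move=> /(_ [set y]) H; apply: (H _ _ (measurable_set1 y)) => // A mA Ay.
by apply: (subset_measure0 mA (measurable_set1 y) Ay); exact: lebesgue_measure_set1.
Qed.

Lemma convex_set_segment {d : nat} (X : set 'rV[R]_d) (u w : 'rV[R]_d) (t : R) :
  convex_set X -> X u -> X w -> 0 <= t <= 1 -> X (u + t *: (w - u)).
Proof.
move=> cX Xu Xw /andP[t0 t1].
have := cX w u (Itv01 t0 t1); rewrite !inE => /(_ Xw Xu).
suff -> : u + t *: (w - u) = conv (Itv01 t0 t1) (w : convex_lmodType _) u by [].
by rewrite /conv/= scalerBr scalerBl scale1r addrCA.
Qed.

Lemma convex_function_segment {d : nat} (X : set 'rV[R]_d) (f : 'rV[R]_d -> R)
    (u w : 'rV[R]_d) (t : R) : convex_function X f -> X u -> X w -> 0 <= t <= 1 ->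
  f (u + t *: (w - u)) <= t * f w + (1 - t) * f u.
Proof.
move=> cf Xu Xw /andP[t0 t1].
have := cf (Itv01 t0 t1) w u; rewrite !inE => /(_ Xw Xu).
suff -> : u + t *: (w - u) = conv (Itv01 t0 t1) (w : convex_lmodType _) u by [].
by rewrite /conv/= scalerBr scalerBl scale1r addrCA.
Qed.

(** Adding the two first-order inequalities of a convex function cancels its values [p] and [p'];
    [v] and [w] will be the gradients of [C_i] and [g_i]. *)
Lemma dotp_monotone_diff {d : nat} (v v' w w' y y' : 'rV[R]_d) (p p' : R) :
  dotp (v - w) (y' - y) <= p' - p -> dotp (v' - w') (y - y') <= p - p' ->
  dotp (w - w') (y - y') <= dotp (v - v') (y - y').
Proof. by rewrite -(opprB y y') dotpNr !dotpBl; lra. Qed.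

Context {N d : nat}.
Implicit Types (x : 'M[R]_(N, d)) (X : 'I_N -> set 'rV[R]_d).

Lemma row_set_action x i u : row i (set_action x i u) = u.
Proof. by apply/rowP => j; rewrite !mxE eqxx. Qed.

Lemma set_action_row x i : set_action x i (row i x) = x.
Proof. by apply/matrixP => k j; rewrite !mxE; case: eqP => [->|]. Qed.

Lemma profiles_set_action X x i u : profiles X x -> X i u ->
  profiles X (set_action x i u).
Proof.
move=> Xx Xu k; have [->|ki] := eqVneq k i; first by rewrite row_set_action.
suff -> : row k (set_action x i u) = row k x by exact: Xx.
by apply/rowP => j; rewrite !mxE (negbTE ki).
Qed.

Lemma dotp_set_action x i (v : 'M[R]_(N, d)) u w :
  dotp v (set_action x i u - set_action x i w) = dotp (row i v) (u - w).
Proof.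
rewrite /dotp big_ord1 (bigD1 i)//= [X in _ + X]big1 ?addr0.
  by apply: eq_bigr => j _; rewrite !mxE eqxx.
by move=> k /negbTE ki; rewrite big1// => j _; rewrite !mxE ki subrr mulr0.
Qed.

Lemma enorm_set_action x i u w :
  enorm (set_action x i u - set_action x i w) = enorm (u - w).
Proof.
rewrite /enorm dotp_set_action; congr (Num.sqrt (dotp _ _)).
by apply/rowP => j; rewrite !mxE eqxx.
Qed.

(** Replacing row [i] embeds [X i] isometrically into the profiles, and only row [i] of [v] pairs
    with such displacements. *)
Lemma is_gradient_set_action X x i (h : 'M[R]_(N, d) -> R) v : profiles X x ->
  is_gradient (profiles X) h x v ->
  is_gradient (X i) (fun u => h (set_action x i u)) (row i x) (row i v).
Proof.
move=> Xx /is_gradientP H; apply/is_gradientP => e /H[t t0 Ht]; exists t => // u Xu ut.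
have := Ht _ (profiles_set_action X x i u Xx Xu).
rewrite (_ : set_action x i u - x = set_action x i u - set_action x i (row i x)).
  by rewrite enorm_set_action dotp_set_action set_action_row; exact.
by rewrite set_action_row.
Qed.

Lemma pgradientP X i (h : 'M[R]_(N, d) -> R) x : pdifferentiable X i h x ->
  is_gradient (X i) (fun u => h (set_action x i u)) (row i x) (pgradient X i h x).
Proof. by move=> hx; exact: (getPex hx). Qed.

End games.

Theorem lemma1 (R : realType) (N d n : nat)
  (dsp : measure_display) (Omega : measurableType dsp) (P : probability Omega R)
  (D m : R) (X : 'I_N -> set 'rV[R]_d) (Xi : 'I_N -> set 'rV[R]_n)
  (xi : 'I_N -> Omega -> 'rV[R]_n) (alpha : 'I_N -> R)
  (J : 'I_N -> 'M[R]_(N, d) -> 'rV[R]_n -> R)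
  (L : 'I_N -> 'rV[R]_n -> R)
  (f : 'I_N -> 'rV[R]_d -> 'rV[R]_n -> R)
  (g : 'I_N -> 'M[R]_(N, d) -> R)
  (* action sets *)
  (X_convex : forall i, convex_set (X i))
  (X_diam : forall i u v, X i u -> X i v -> enorm (u - v) <= D)
  (* the random variables xi_i, with values in Xi_i *)
  (xi_meas : forall i k, measurable_fun setT (fun w => xi i w 0 k))
  (xi_Xi : forall i w, Xi i (xi i w))
  (alpha01 : forall i, 0 < alpha i <= 1)
  (* the costs J_i, with L i z a Lipschitz constant of J_i(., z) *)
  (J_convex : forall i x z, profiles X x -> Xi i z ->
     convex_function (X i) (fun u => J i (set_action x i u) z))
  (J_lipschitz : forall i z, Xi i z -> forall x x',
     profiles X x -> profiles X x' ->
     `|J i x z - J i x' z| <= L i z * enorm (x - x'))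
  (J_diff : forall i z, Xi i z ->
     differentiable_on (profiles X) (fun x => J i x z))
  (C_fin : forall i x, profiles X x ->
     CVaR P (alpha i) (fun w => J i x (xi i w)) \is a fin_num)
  (* the decomposition J_i = f_i + g_i *)
  (J_decomp : forall i x z, profiles X x -> Xi i z ->
     J i x z = f i (row i x) z + g i x)
  (f_meas : forall i u, X i u ->
     measurable_fun setT (fun w => f i u (xi i w)))
  (f_abs_cont : forall i u, X i u ->
     pushforward P (fun w => f i u (xi i w)) `<< @lebesgue_measure R)
  (f_VaR_diff : forall i, alpha i < 1 ->
     differentiable_on (X i)
       (fun u => fine (VaR P (alpha i) (fun w => f i u (xi i w)))))
  (f_convex : forall i z, Xi i z -> convex_function (X i) (fun u => f i u z))
  (g_diff : forall i x, profiles X x -> pdifferentiable X i (g i) x)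
  (g_mono : forall x x', profiles X x -> profiles X x' ->
     strongly_monotone_at X m g x x') :
  let C := risk_cost P alpha J xi in
  (forall x x', profiles X x -> profiles X x' ->
     (forall i, pdifferentiable X i (C i) x) ->
     (forall i, pdifferentiable X i (C i) x') ->
     strongly_monotone_at X m C x x') /\
  (forall i, P.-integrable setT (fun w => (L i (xi i w))%:E) ->
     forall x, profiles X x -> pdifferentiable X i (C i) x).

Proof.
(* For a fixed profile [g i x] is a constant, so the level sets of the cost are level sets of
   [f]. *)
have J_regular i x : profiles X x -> regular_loss P (alpha i) (fun w => J i x (xi i w)).
  move=> Xx; have JE w : J i x (xi i w) = f i (row i x) (xi i w) + g i x.
    exact: J_decomp.
  split; last exact: C_fin.
    under eq_fun do rewrite JE.
    by apply: measurable_funD => //; exact: f_meas.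
  move=> y; rewrite (_ : [set w | _] = [set w | f i (row i x) (xi i w) = y - g i x]).
    by apply: abs_cont_atomless; exact: f_abs_cont.
  by apply/seteqP; split=> w /=; rewrite JE; [move=> <-; rewrite addrK|move=> ->; rewrite subrK].
move=> C; split; last first.
  move=> i iL x Xx.
  apply: (CVaR_differentiable P (alpha i) (X i)
    (fun u w => J i (set_action x i u) (xi i w)) (fun w => L i (xi i w))) => //.
  - move=> y t Xy /andP[t0 t1]; apply: convex_set_segment => //.
    by rewrite ltW.
  - by move=> y Xy; apply: J_regular; exact: profiles_set_action.
  - move=> w y z Xy Xz; rewrite -(enorm_set_action x i).
    by apply: J_lipschitz => //; exact: profiles_set_action.
  - move=> w; have [v hv] := J_diff i _ (xi_Xi i w) x Xx.
    exists (row i v).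
    exact: (is_gradient_set_action X x i (fun y => J i y (xi i w))).
move=> x x' Xx Xx' Cx Cx'.
apply: le_trans (g_mono x x' Xx Xx') _; apply: ler_sum => i _.
pose F u := C i (set_action x i u) - g i (set_action x i u).
have Fconv u w t : X i u -> X i w -> 0 < t < 1 ->
    F (u + t *: (w - u)) <= t * F w + (1 - t) * F u.
  move=> Xu Xw t01; have t01' : 0 <= t <= 1 by case/andP: t01 => ? ?; rewrite !ltW.
  have Xt := convex_set_segment _ _ _ _ (X_convex i) Xu Xw t01'.
  have prof := profiles_set_action X x i _ Xx.
  (* The constant is the convexity defect of [g]: once it is moved across, the pointwise hypothesis
     is just the convexity of [f]. *)
  have := CVaR_convex P (alpha i) t
    (g i (set_action x i (u + t *: (w - u))) - t * g i (set_action x i w)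
       - (1 - t) * g i (set_action x i u)) _ _ _ (alpha01 i) t01
    (J_regular i _ (prof _ Xt)) (J_regular i _ (prof _ Xw)) (J_regular i _ (prof _ Xu)).
  move=> H; suff : C i (set_action x i (u + t *: (w - u))) <=
      t * C i (set_action x i w) + (1 - t) * C i (set_action x i u) +
      (g i (set_action x i (u + t *: (w - u))) - t * g i (set_action x i w)
       - (1 - t) * g i (set_action x i u)) by rewrite /F; lra.
  apply: H => z; rewrite !J_decomp ?row_set_action//; last 3 first.
  - exact: prof.
  - exact: prof.
  - exact: prof.
  have := convex_function_segment _ _ _ _ _ (f_convex i _ (xi_Xi i z)) Xu Xw t01'.
  lra.
(* The risk of [J_i] minus [g_i] depends on the action of player [i] only. *)
have FE u : X i u -> F u = C i (set_action x' i u) - g i (set_action x' i u).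
  move=> Xu; have h01 : 0 < (2^-1 : R) < 1 by rewrite invr_gt0 invf_lt1// ltr1n ltr0n.
  have p := profiles_set_action X x i _ Xx Xu.
  have p' := profiles_set_action X x' i _ Xx' Xu.
  pose c := g i (set_action x i u) - g i (set_action x' i u).
  (* Using the same loss twice with weight one half gives monotonicity up to a shift; the shifts [c]
     and [- c] together give equality. *)
  have := CVaR_convex P (alpha i) 2^-1 c _ _ _ (alpha01 i) h01
    (J_regular i _ p) (J_regular i _ p') (J_regular i _ p').
  have := CVaR_convex P (alpha i) 2^-1 (- c) _ _ _ (alpha01 i) h01
    (J_regular i _ p') (J_regular i _ p) (J_regular i _ p).
  rewrite /F /C /risk_cost.
  set r' := fine _; set r := fine _ => H1 H2.
  apply/eqP; rewrite eq_le; apply/andP; split.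
    have : r <= 2^-1 * r' + (1 - 2^-1) * r' + c.
      by apply: H2 => w; rewrite !J_decomp// !row_set_action /c; lra.
    by rewrite /c; lra.
  have : r' <= 2^-1 * r + (1 - 2^-1) * r - c.
    by apply: H1 => w; rewrite !J_decomp// !row_set_action /c; lra.
  by rewrite /c; lra.
have G : is_gradient (X i) F (row i x) (pgradient X i (C i) x - pgradient X i (g i) x).
  by apply: is_gradientB; apply: pgradientP => //; exact: g_diff.
(* [F] was built with the opponents' actions in [x]; [FE] lets the gradients at [x'] refer to the
   same function. *)
have G' : is_gradient (X i) F (row i x') (pgradient X i (C i) x' - pgradient X i (g i) x').
  apply: eq_is_gradient (Xx' i) (fun u Xu => esym (FE u Xu)) _.
  by apply: is_gradientB; apply: pgradientP => //; exact: g_diff.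
have mono : dotp (pgradient X i (C i) x - pgradient X i (g i) x) (row i x' - row i x)
    <= F (row i x') - F (row i x).
  apply: is_gradient_convex_le G _ => t t01; split; last exact: Fconv.
  by apply: convex_set_segment => //; case/andP: t01 => ? ?; rewrite !ltW.
have mono' : dotp (pgradient X i (C i) x' - pgradient X i (g i) x') (row i x - row i x')
    <= F (row i x) - F (row i x').
  apply: is_gradient_convex_le G' _ => t t01; split; last exact: Fconv.
  by apply: convex_set_segment => //; case/andP: t01 => ? ?; rewrite !ltW.
exact: dotp_monotone_diff mono mono'.
Qed.
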